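(* Let $C\subset\mathbb{R}^n$ be a convex body. If every $C$-ball convex set is finitely generated, then $C$ is an $n$-polytope.
   Context: A convex body is a compact convex set with non-empty interior; an $n$-polytope is an $n$-dimensional convex body that is the convex hull of finitely many points. A set $K\subset\mathbb{R}^n$ is $C$-ball convex if it is $\emptyset$, or $\mathbb{R}^n$, or the intersection of all translates of $C$ that contain $K$. The $C$-ball convex hull of a set $A$ is the intersection of all $C$-ball convex sets that contain $A$. ''Every $C$-ball convex set is finitely generated'' means that every $C$-ball convex set is the $C$-ball convex hull of finitely many points. *)

(* Defs.v *)
From HB Require Import structures.
From mathcomp Require Import all_boot all_order all_algebra.
From mathcomp Require Import all_classical all_reals all_analysis.

Set Implicit Arguments.
Unset Strict Implicit.
Unset Printing Implicit Defensive.

Import Order.TTheory GRing.Theory Num.Theory.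
Import numFieldNormedType.Exports.

Local Open Scope classical_set_scope.
Local Open Scope ring_scope.

Definition convex_body (R : realType) (n : nat) (K : set 'rV[R]_n) : Prop :=
  [/\ compact K, @convex_set R 'rV[R]_n K & K° !=set0].

Definition convex_hull (R : realType) (n : nat) (A : set 'rV[R]_n) :
  set 'rV[R]_n := smallest (@convex_set R 'rV[R]_n) A.

(* Full dimension is part of [convex_body]: the interior in R^n is nonempty. *)
Definition n_polytope (R : realType) (n : nat) (P : set 'rV[R]_n) : Prop :=
  convex_body P /\
  exists2 F : set 'rV[R]_n, finite_set F & P = convex_hull F.

Definition translate (R : realType) (n : nat) (x : 'rV[R]_n)
  (C : set 'rV[R]_n) : set 'rV[R]_n := [set x + y | y in C].

(* When no translate of C contains K, the intersection over no index is the
   whole space, in agreement with the second disjunct. *)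
Definition ball_convex (R : realType) (n : nat) (C K : set 'rV[R]_n) : Prop :=
  [\/ K = set0, K = setT |
      K = \bigcap_(x in [set x | K `<=` translate x C]) translate x C].

Definition ball_convex_hull (R : realType) (n : nat) (C A : set 'rV[R]_n) :
  set 'rV[R]_n := smallest (ball_convex C) A.

(* F may be empty: the empty set is the hull of no points. *)
Definition finitely_generated (R : realType) (n : nat) (C K : set 'rV[R]_n) :
  Prop :=
  exists2 F : set 'rV[R]_n, finite_set F & K = ball_convex_hull C F.

(* Main.v *)
Require Import Defs.
From mathcomp Require Import all_boot all_order all_algebra.
From mathcomp Require Import all_classical all_reals all_analysis.
From mathcomp Require Import ring lra.

(** The hypothesis says that for every set A the body of all x with A + x in C
    is already cut out by a finite set F.  Suppose some p in C is a limit of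
    boundary points y_k at which a ball inside C touches the boundary with
    normal u_k, the supporting hyperplane at y_k missing p.  Put
    a_k = t_k (y_k - p) with t_k small and generic.  In the body cut out by
    A = {a_k}, a ball touches the boundary at y_k - a_k, where only the
    constraint a_k is active; so some f in F lies on the hyperplane
    {f | <u_k, f> = <u_k, a_k>}.  By genericity no f lies on more than n of
    these hyperplanes, contradicting the finiteness of F.  Hence near each p in
    C all such supporting hyperplanes pass through p, so C is locally a cone
    with apex p.  By compactness finitely many of these conical neighbourhoods
    cover C, and C is the convex hull of their apexes: a linear functional
    separating a point of C from that hull would attain its maximum over C at a
    point from which one can still move away from one of the apexes. *)

Set Implicit Arguments.
Unset Strict Implicit.
Unset Printing Implicit Defensive.

Import Order.TTheory GRing.Theory Num.Theory.
Import numFieldNormedType.Exports.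

Local Open Scope classical_set_scope.
Local Open Scope ring_scope.

(** * The Euclidean inner product *)

Section InnerProduct.
Context {R : realType} {n : nat}.
Implicit Types u v w x y z : 'rV[R]_n.

Definition dot u v : R := \sum_i u 0 i * v 0 i.

Lemma dotC u v : dot u v = dot v u.
Proof. by apply: eq_bigr => i _; rewrite mulrC. Qed.

Lemma dotDr u v w : dot u (v + w) = dot u v + dot u w.
Proof. by rewrite -big_split; apply: eq_bigr => i _; rewrite mxE mulrDr. Qed.

Lemma dotZr a u v : dot u (a *: v) = a * dot u v.
Proof. by rewrite mulr_sumr; apply: eq_bigr => i _; rewrite mxE; ring. Qed.

Lemma dotNr u v : dot u (- v) = - dot u v.
Proof. by rewrite -scaleN1r dotZr mulN1r. Qed.

Lemma dotDl u v w : dot (u + v) w = dot u w + dot v w.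
Proof. by rewrite !(dotC _ w) dotDr. Qed.

Lemma dotZl a u v : dot (a *: u) v = a * dot u v.
Proof. by rewrite !(dotC _ v) dotZr. Qed.

Lemma dotNl u v : dot (- u) v = - dot u v.
Proof. by rewrite !(dotC _ v) dotNr. Qed.

Definition dotE := (dotDl, dotDr, dotNl, dotNr, dotZl, dotZr).

Lemma dot_ge0 u : 0 <= dot u u.
Proof. by apply: sumr_ge0 => i _; rewrite -expr2 sqr_ge0. Qed.

Lemma dot_gt0 u : u != 0 -> 0 < dot u u.
Proof.
rewrite lt_def dot_ge0 andbT; apply: contraNneq => /eqP.
rewrite psumr_eq0 => [/allP u0|i _]; last by rewrite -expr2 sqr_ge0.
apply/eqP/rowP => i; have := u0 i; rewrite mem_index_enum => /(_ isT).
by rewrite mulf_eq0 orbb mxE => /eqP.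
Qed.

Lemma continuous_dotB c : continuous (fun z => dot (z - c) (z - c)).
Proof.
have cB (i : 'I_n) : continuous (fun z => (z - c) 0 i).
  rewrite (_ : (fun z => _) = fun z => z 0 i - c 0 i); last first.
    by apply/funext => z; rewrite !mxE.
  move=> z; apply: continuousB; last exact: cst_continuous.
  exact: coord_continuous.
apply: continuous_big => [z|i _ z]; first exact: add_continuous.
by apply: continuousM; apply: cB.
Qed.

Lemma continuous_dot u : continuous (dot u).
Proof.
apply: continuous_big => [z|i _ z]; first exact: add_continuous.
by apply: continuousM; [exact: cst_continuous|exact: coord_continuous].
Qed.

(** The norm is the supremum norm, while touching balls are Euclidean; this crude bound passes
    between them without square roots. *)
Lemma norm_le_dot w r : dot w w <= r -> `|w| <= 1 + r.
Proof.
move=> wr; rewrite [leLHS]/Num.norm /= mx_normrE.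
have r0 := le_trans (dot_ge0 w) wr.
apply/bigmax_leP; split=> [|[i j] _] /=; first by lra.
rewrite ord1; have : w 0 j * w 0 j <= r.
  apply: le_trans wr; rewrite /dot (bigD1 j)//= lerDl.
  by apply: sumr_ge0 => k _; rewrite -expr2 sqr_ge0.
by move=> h; have := sqr_ge0 (`|w 0 j| - 1); rewrite sqrrB real_normK ?num_real//;
  rewrite expr2; nra.
Qed.

End InnerProduct.

(** * Convex sets and their interiors *)

Section Convexity.
Context {R : realType} {n : nat}.
Implicit Types (K : set 'rV[R]_n) (x y z v : 'rV[R]_n).

Lemma convex_setP K : @convex_set R 'rV[R]_n K <->
  forall x y t, K x -> K y -> 0 <= t <= 1 -> K (t *: x + (1 - t) *: y).
Proof.
split=> [cK x y t Kx Ky t01|cK x y l /set_mem Kx /set_mem Ky]; last first.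
  by apply/mem_set/cK => //; rewrite ge0 le1.
have it : Itv.spec (@Itv.num_sem R) (Itv.Real `[0%Z, 1%Z]) t.
  by rewrite /= /Itv.num_sem /= in_itv/= t01 andbT; apply: num_real.
by have /set_mem := cK x y (Itv.mk it) (mem_set Kx) (mem_set Ky).
Qed.

Lemma interior_ballP K x :
  K° x <-> exists2 e, 0 < e & forall v, `|v| < e -> K (x + v).
Proof.
split=> [/nbhs_ballP[e /= e0 he]|[e e0 he]].
  exists e => // v ve; apply: he; rewrite -ball_normE /=.
  by rewrite opprD addrA subrr sub0r normrN.
apply/nbhs_ballP; exists e => // z; rewrite -ball_normE /= => xz.
by rewrite -(subrKC x z); apply: he; rewrite distrC.
Qed.

(** The homothety with centre [z] and ratio [1 - t] maps a ball in [K] around [b] to a ball in [K]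
    around the combination. *)
Lemma interior_combination K b z t : @convex_set R 'rV[R]_n K ->
  K° b -> K z -> 0 <= t < 1 -> K° ((1 - t) *: b + t *: z).
Proof.
move=> /convex_setP cK /interior_ballP[e e0 he] Kz t01.
apply/interior_ballP; exists ((1 - t) * e); first by rewrite mulr_gt0//; lra.
move=> v vlt.
have -> : (1 - t) *: b + t *: z + v
    = t *: z + (1 - t) *: (b + (1 - t)^-1 *: v).
  by apply/rowP => i; rewrite !mxE; field; lra.
apply: cK => //; last by lra.
apply: he; rewrite normrZ normfV ger0_norm ?subr_ge0; last by lra.
by rewrite mulrC ltr_pdivrMr; [rewrite mulrC|lra].
Qed.

End Convexity.

(** * Boundary points touched by an inner ball *)

Section Touch.
Context {R : realType} {n : nat}.
Implicit Types (C : set 'rV[R]_n) (c p u v w x y z : 'rV[R]_n).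

(* An open Euclidean ball centred at [c] and contained in [C] reaches the
   boundary of [C] at [y]; then [y - c] is an outer normal at [y]. *)
Definition touch C c y := [/\ C y, ~ C° y, y != c &
  forall z, dot (z - c) (z - c) < dot (y - c) (y - c) -> C z].

(** The squared distance to [c] decreases to first order along [v], so a short step enters the open
    ball, whose points are interior to [C]. *)
Lemma touch_enter C c y v : touch C c y -> dot (y - c) v < 0 ->
  exists2 s, 0 < s < 1 & C° (y + s *: v).
Proof.
move=> [_ _ _ yC] uv; set u : 'rV[R]_n := y - c in uv yC *.
have uE : y - c = u by []; clearbody u.
have vv := dot_ge0 v.
pose s := - dot u v / (1 + dot v v - dot u v).
have d0 : 0 < 1 + dot v v - dot u v by lra.
have s0 : 0 < s by rewrite divr_gt0//; lra.
exists s; first by rewrite s0 ltr_pdivrMr//; lra.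
have small : dot (y + s *: v - c) (y + s *: v - c) < dot u u.
  have -> : y + s *: v - c = u + s *: v by rewrite addrAC uE.
  rewrite !dotE (dotC v u).
  have sd : s * (1 + dot v v - dot u v) = - dot u v by rewrite mulfVK// gt_eqF.
  nra.
have /cvgr_lt/(_ _ small) := @continuous_dotB _ _ c (y + s *: v).
exact: filterS.
Qed.

(** If [z] lay beyond the hyperplane, the direction [y - z] would enter the interior, and [y],
    between [z] and an interior point, would be interior. *)
Lemma touch_max C c y z : @convex_set R 'rV[R]_n C -> touch C c y -> C z ->
  dot (y - c) z <= dot (y - c) y.
Proof.
move=> cC tcy Cz; rewrite leNgt; apply/negP => lt.
have [|s s01 Cs] := @touch_enter C c y (y - z) tcy.
  by rewrite dotDr dotNr; lra.
have [_ + _ _] := tcy; apply.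
have -> : y = (1 - s / (1 + s)) *: (y + s *: (y - z)) + (s / (1 + s)) *: z.
  by apply/rowP => i; rewrite !mxE; field; lra.
apply: interior_combination => //.
by rewrite divr_ge0 ?ltr_pdivrMr//=; lra.
Qed.

(** [touch_enter] gives one interior point of the segment; the others lie between it and an
    endpoint. *)
Lemma touch_segment C c y p t : @convex_set R 'rV[R]_n C -> touch C c y ->
  C p -> dot (y - c) p < dot (y - c) y -> 0 < t < 1 -> C° (y + t *: (p - y)).
Proof.
move=> cC tcy Cp lt t01.
have [|s s01 Cs] := @touch_enter C c y (p - y) tcy.
  by rewrite dotDr dotNr; lra.
have [Cy _ _ _] := tcy.
have [ts|st] := leP t s.
  have -> : y + t *: (p - y)
      = (1 - (1 - t / s)) *: (y + s *: (p - y)) + (1 - t / s) *: y.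
    by apply/rowP => i; rewrite !mxE; field; lra.
  apply: interior_combination => //.
  rewrite subr_ge0 ler_pdivrMr ?mul1r ?ltrBlDr ?ltrDl ?divr_gt0//; lra.
have -> : y + t *: (p - y) = (1 - (t - s) / (1 - s)) *: (y + s *: (p - y))
    + ((t - s) / (1 - s)) *: p.
  by apply/rowP => i; rewrite !mxE; field; lra.
apply: interior_combination => //.
by rewrite divr_ge0 ?ltr_pdivrMr//=; lra.
Qed.

(** Contracting the ball towards [y] keeps it inside [C], so touching can be tested arbitrarily near
    [y]. *)
Lemma touch_shrink C c y e : touch C c y -> 0 < e ->
  exists2 s, 0 < s & forall z,
    dot (z - (y - s *: (y - c))) (z - (y - s *: (y - c)))
      < s ^+ 2 * dot (y - c) (y - c) -> C z /\ `|z - y| < e.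
Proof.
move=> [_ _ _ yC] e0; set u : 'rV[R]_n := y - c in yC *.
have uE : y - c = u by []; clearbody u.
have uu := dot_ge0 u.
have d0 : 0 < 1 + dot u u + `|u| + e by have := normr_ge0 u; lra.
pose s := e / (1 + dot u u + `|u| + e).
have s0 : 0 < s by rewrite divr_gt0.
have s1 : s < 1 by rewrite ltr_pdivrMr// mul1r; have := normr_ge0 u; lra.
exists s => // z.
set w : 'rV[R]_n := s^-1 *: (z - (y - s *: u)).
have zE : z = y - s *: u + s *: w.
  by rewrite scalerA divff ?gt_eqF// scale1r subrKC.
clearbody w; rewrite {1 2}zE addrC addKr !dotE mulrA -expr2.
rewrite ltr_pM2l ?exprn_gt0// => ww.
split.
  apply: yC; have -> : z - c = (1 - s) *: u + s *: w.
    by rewrite {1}zE -uE; apply/rowP => i; rewrite !mxE; ring.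
  rewrite !dotE (dotC w u).
  have : 0 < s * (dot u u - dot w w) by rewrite mulr_gt0// subr_gt0.
  (* This product is the exact gap in the convexity inequality of the squared norm at
     [(1 - s) *: u + s *: w]. *)
  have : 0 <= s * (1 - s) * dot (u - w) (u - w).
    by apply: mulr_ge0 (dot_ge0 _); apply: mulr_ge0; lra.
  by rewrite !dotE (dotC w u); lra.
have -> : z - y = s *: (w - u).
  by rewrite {1}zE; apply/rowP => i; rewrite !mxE; ring.
rewrite normrZ gtr0_norm//.
have wu : `|w - u| <= 1 + dot u u + `|u|.
  by apply: le_trans (ler_normB _ _) _; rewrite lerD2r norm_le_dot// ltW.
rewrite /s mulrAC ltr_pdivrMr// ltr_pM2l//.
by apply: le_lt_trans wu _; rewrite ltrDl.
Qed.

Lemma closed_ball_center C c y : closed C -> y != c ->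
  (forall z, dot (z - c) (z - c) < dot (y - c) (y - c) -> C z) -> C y.
Proof.
move=> clC yc yC; apply: contrapT => nCy.
have : (~` C)° y by apply: open_nbhs_nbhs; split=> //; exact: closed_openC.
move=> /interior_ballP[e e0 he].
have u0 : 0 < dot (y - c) (y - c) by rewrite dot_gt0// subr_eq0.
set u : 'rV[R]_n := y - c in yC u0 *.
have uE : y - c = u by []; clearbody u.
have d0 : 0 < 1 + `|u| + e by have := normr_ge0 u; lra.
pose s := e / (1 + `|u| + e).
have s0 : 0 < s by rewrite divr_gt0.
have s1 : s < 1 by rewrite ltr_pdivrMr// mul1r; have := normr_ge0 u; lra.
apply: (he (- s *: u)).
  rewrite normrZ normrN gtr0_norm// mulrAC ltr_pdivrMr// ltr_pM2l//.
  by rewrite ltr_wpDr ?ltrDr ?ltW.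
apply: yC; have -> : y + - s *: u - c = (1 - s) *: u.
  by rewrite -uE; apply/rowP => i; rewrite !mxE; ring.
have : 0 < s * (2 - s) * dot u u by rewrite mulr_gt0// mulr_gt0//; lra.
by rewrite !dotE; lra.
Qed.

(* The witness is the point outside the interior nearest to [c]. *)
Lemma touch_nearest C c y0 : closed C -> C° c -> ~ C° y0 ->
  exists2 y, touch C c y & dot (y - c) (y - c) <= dot (y0 - c) (y0 - c).
Proof.
move=> clC Cc Cy0.
pose S := ~` C° `&` [set z | dot (z - c) (z - c) <= dot (y0 - c) (y0 - c)].
have Sy0 : S y0 by split=> //=.
have cS : compact S.
  apply: bounded_closed_compact.
    exists (`|c| + (1 + dot (y0 - c) (y0 - c))); split; first exact: num_real.
    move=> M ltM z [_ /= /norm_le_dot zc].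
    apply/ltW/(le_lt_trans _ ltM); rewrite -[z in `|z|](subrKC c).
    by apply: le_trans (ler_normD _ _) _; rewrite lerD2l.
  apply: closedI; first by apply: open_closedC; exact: open_interior.
  apply: (@closed_comp _ _ _ [set r : R | r <= dot (y0 - c) (y0 - c)]).
    by move=> z _; exact: continuous_dotB.
  exact: closed_le.
have [|y /set_mem[nCy /= yy0] ymin] := EVT_min_rV (ex_intro _ y0 Sy0) cS
    (f := fun z => dot (z - c) (z - c)).
  by apply: continuous_subspaceT => z; exact: continuous_dotB.
have yc : y != c by apply: contra_not_neq nCy => ->.
have yC z : dot (z - c) (z - c) < dot (y - c) (y - c) -> C z.
  move=> lt; apply: contrapT => nCz; have : z \in S.
    apply/mem_set; split; last exact: ltW (lt_le_trans lt yy0).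
    by move=> /interior_subset.
  by move=> /ymin; rewrite leNgt lt.
by exists y => //; split=> //; exact: closed_ball_center yc yC.
Qed.

(** The centre is an interior point close to [y0]; the nearest non-interior point is no farther from
    it than [y0], hence close to [y0]. *)
Lemma touch_dense C y0 e : convex_body C -> C y0 -> ~ C° y0 -> 0 < e ->
  exists c y, touch C c y /\ `|y - y0| < e.
Proof.
move=> [cptC cC [b Cb]] Cy0 nCy0 e0.
have clC : closed C by apply: compact_closed => //; exact: norm_hausdorff.
set d : 'rV[R]_n := y0 - b.
have dE : y0 - b = d by []; clearbody d.
have d0 : 0 < 1 + dot d d + `|d| + e.
  by have := normr_ge0 d; have := dot_ge0 d; lra.
pose s := e / (1 + dot d d + `|d| + e).
have s0 : 0 < s by rewrite divr_gt0.
have s1 : s < 1.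
  by rewrite ltr_pdivrMr// mul1r; have := normr_ge0 d; have := dot_ge0 d; lra.
have Cc : C° (y0 - s *: d).
  have -> : y0 - s *: d = (1 - (1 - s)) *: b + (1 - s) *: y0.
    by rewrite -dE; apply/rowP => i; rewrite !mxE; ring.
  by apply: interior_combination => //; lra.
have [y ty b0] := touch_nearest clC Cc nCy0.
exists (y0 - s *: d), y; split=> //.
set w : 'rV[R]_n := s^-1 *: (y - (y0 - s *: d)).
have sw : s *: w = y - (y0 - s *: d) by rewrite scalerA divff ?gt_eqF// scale1r.
clearbody w.
have ww : dot w w <= dot d d.
  rewrite -(ler_pM2l (mulr_gt0 s0 s0)).
  by move: b0; rewrite -sw subKr !dotE !mulrA.
have -> : y - y0 = s *: (w - d).
  by rewrite scalerBr sw; apply/rowP => i; rewrite !mxE; ring.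
rewrite normrZ gtr0_norm//.
have wd : `|w - d| <= 1 + dot d d + `|d|.
  by apply: le_trans (ler_normB _ _) _; rewrite lerD2r norm_le_dot.
rewrite /s mulrAC ltr_pdivrMr// ltr_pM2l//.
by apply: le_lt_trans wd _; rewrite ltrDl.
Qed.

End Touch.

(** * Locally conical bodies are polytopes *)

Section LocallyConical.
Context {R : realType} {n : nat}.
Implicit Types (C K : set 'rV[R]_n) (c p q u v w x y z : 'rV[R]_n).

(** [t] is the largest parameter in [[0, 1]] whose point lies in [C]; at an interior point it could
    still grow. *)
Lemma segment_exit C c x : closed C -> C c -> ~ C x ->
  exists t, [/\ 0 <= t < 1, C (c + t *: (x - c)) & ~ C° (c + t *: (x - c))].
Proof.
move=> clC Cc nCx; pose g (t : R) := c + t *: (x - c).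
have cg : continuous g.
  by move=> t; apply: cvgD; [exact: cvg_cst|apply: cvgZr_tmp; exact: cvg_id].
pose A : set R := `[0, 1] `&` g @^-1` C.
have cA : compact A.
  apply: compact_closedI; first exact: segment_compact.
  by apply: closed_comp => // t _; exact: cg.
have A0 : A !=set0.
  by exists 0; split; rewrite /= ?in_itv /= ?lexx ?ler01// /g scale0r addr0.
have [|t /set_mem[]] := compact_EVT_max A0 cA (f := id).
  by apply: continuous_subspaceT => ?; exact: cvg_id.
rewrite /= in_itv /= => /andP[t0 t1] Cgt tmax.
have {}t1 : t < 1.
  rewrite lt_neqAle t1 andbT; apply: contra_not_neq nCx => t1'.
  by move: Cgt; rewrite /g t1' scale1r subrKC.
exists t; split=> //; first by rewrite t0.
move=> /interior_ballP[e e0 he].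
have d0 : 0 < 1 + `|x - c| + e by have := normr_ge0 (x - c); lra.
pose m := Num.min (1 - t) (e / (1 + `|x - c| + e)).
have m0 : 0 < m by rewrite lt_min divr_gt0// subr_gt0 t1.
have m1 : m <= 1 - t by rewrite ge_min lexx.
have me : m * `|x - c| < e.
  apply: (@le_lt_trans _ _ (e / (1 + `|x - c| + e) * `|x - c|)).
    by rewrite ler_wpM2r// ge_min lexx orbT.
  rewrite mulrAC ltr_pdivrMr// ltr_pM2l//; lra.
have : t + m \in A.
  apply/mem_set; split; first by rewrite /= in_itv/=; lra.
  rewrite /preimage /= /g scalerDl addrA; apply: he.
  by rewrite normrZ gtr0_norm.
by move=> /tmax /=; rewrite gerDl leNgt m0.
Qed.

(* The conclusion says that near [p] the body is a cone with apex [p]. *)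
Lemma locally_conical C p r : convex_body C -> C p -> 0 < r ->
  (forall c y, touch C c y -> `|y - p| < r -> dot (y - c) y <= dot (y - c) p) ->
  forall x, C x -> `|x - p| < r -> exists2 s, 0 < s & C (x + s *: (x - p)).
Proof.
move=> bC Cp r0 hp x Cx xr; have [cptC cC [b Cb]] := bC.
have clC : closed C by apply: compact_closed => //; exact: norm_hausdorff.
pose s := (r - `|x - p|) / (2 * r).
have s0 : 0 < s by rewrite divr_gt0 ?subr_gt0// mulr_gt0.
exists s => //; apply: contrapT.
set x' := x + s *: (x - p) => nCx'.
have x'r : `|x' - p| < r.
  have -> : x' - p = (1 + s) *: (x - p).
    by apply/rowP => i; rewrite !mxE; ring.
  rewrite normrZ gtr0_norm ?addr_gt0//.
  have : s * (2 * r) = r - `|x - p| by rewrite /s mulfVK// mulf_neq0 ?gt_eqF.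
  by clearbody s; have := normr_ge0 (x - p); nra.
have [c Cc cr] : exists2 c, C° c & `|c - p| < r.
  have d0 : 0 < 1 + `|b - p| + r by have := normr_ge0 (b - p); lra.
  pose k := r / (1 + `|b - p| + r).
  have k0 : 0 < k by rewrite divr_gt0.
  have k1 : k < 1.
    by rewrite ltr_pdivrMr// mul1r; have := normr_ge0 (b - p); lra.
  exists ((1 - (1 - k)) *: b + (1 - k) *: p).
    by apply: interior_combination => //; lra.
  have -> : (1 - (1 - k)) *: b + (1 - k) *: p - p = k *: (b - p).
    by apply/rowP => i; rewrite !mxE; ring.
  rewrite normrZ gtr0_norm// /k mulrAC ltr_pdivrMr// ltr_pM2l//.
  by lra.
have [t [/andP[t0 t1] Cy0 nCy0]] := segment_exit clC (interior_subset Cc) nCx'.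
move: Cy0 nCy0; set y0 := c + t *: (x' - c) => Cy0 nCy0.
have y0r : `|y0 - p| < r.
  have -> : y0 - p = (1 - t) *: (c - p) + t *: (x' - p).
    by apply/rowP => i; rewrite !mxE; ring.
  apply: le_lt_trans (ler_normD _ _) _.
  rewrite !normrZ (ger0_norm t0) ger0_norm ?subr_ge0 ?ltW//; nra.
have /interior_ballP[d d0 hd] := Cc.
have [|c1 [y [ty yy0]]] := @touch_dense _ _ C y0
    (Num.min ((1 - t) * d) (r - `|y0 - p|)) bC Cy0 nCy0.
  by rewrite lt_min mulr_gt0 ?subr_gt0.
move: yy0; rewrite lt_min => /andP[yd yr].
set u := y - c1.
(* The supporting hyperplane at [y] passes through [p], so [x'], on the ray from [p] through [x],
   stays on the same side as [x]. *)
have uy : dot u y = dot u p.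
  apply/eqP; rewrite eq_le (touch_max cC ty Cp) andbT hp//.
  rewrite -(subrKA y0); apply: le_lt_trans (ler_normD _ _) _.
  by rewrite -ltrBrDr.
have ux := touch_max cC ty Cx; rewrite -/u in ux.
have ux' : dot u x' <= dot u y.
  by rewrite /x' dotDr dotZr dotDr dotNr -uy; nra.
have u0 : 0 < dot u u by have [_ _ ? _] := ty; rewrite dot_gt0// subr_eq0.
have d1 : 0 < 1 + `|u| by have := normr_ge0 u; lra.
(* [z] lies strictly beyond the hyperplane, yet so near [y0] that it is a combination of [x'] and a
   point of the ball around [c], neither of which is beyond it. *)
pose k := ((1 - t) * d - `|y - y0|) / (1 + `|u|).
have k0 : 0 < k by rewrite divr_gt0// subr_gt0.
pose z := y + k *: u.
have zd : `|z - y0| < (1 - t) * d.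
  have -> : z - y0 = k *: u + (y - y0).
    by rewrite /z addrC addrCA addrA [in RHS]addrC.
  apply: le_lt_trans (ler_normD _ _) _; rewrite -ltrBrDr normrZ gtr0_norm//.
  by rewrite /k mulrAC ltr_pdivrMr// ltr_pM2l ?subr_gt0//; lra.
pose c' := (1 - t)^-1 *: (z - y0).
have Cc' : C (c + c').
  apply: hd; rewrite normrZ normfV gtr0_norm ?subr_gt0// mulrC.
  by rewrite ltr_pdivrMr ?subr_gt0// mulrC.
have e2 := touch_max cC ty Cc'; rewrite -/u in e2.
have zE : z = t *: x' + (1 - t) *: (c + c').
  by apply/rowP => i; rewrite !mxE; field; lra.
have e1 : dot u z = dot u y + k * dot u u by rewrite dotDr dotZr.
rewrite zE dotDr !(dotZr _ u) in e1.
have : 0 < k * dot u u by rewrite mulr_gt0.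
have : 0 <= t * (dot u y - dot u x') by rewrite mulr_ge0// subr_ge0.
have : 0 <= (1 - t) * (dot u y - dot u (c + c')).
  by apply: mulr_ge0; lra.
lra.
Qed.

(** The convex hull of a list, built by iterated joins so that compactness comes from continuous
    images of products. The singleton matters when the tail is empty, since the join is then
    empty. *)
Fixpoint hull_seq (s : seq 'rV[R]_n) : set 'rV[R]_n :=
  if s is p :: s' then [set p] `|`
    (fun tq => tq.1 *: p + (1 - tq.1) *: tq.2) @` (`[0, 1] `*` hull_seq s')
  else set0.

Lemma mem_hull_seq s p : p \in s -> hull_seq s p.
Proof.
elim: s => //= p' s IH; rewrite inE => /predU1P[->|/IH hp]; first by left.
right; exists (0, p); last by rewrite /= scale0r add0r subr0 scale1r.
by split=> //=; rewrite in_itv /= lexx ler01.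
Qed.

Lemma compact_hull_seq s : compact (hull_seq s).
Proof.
elim: s => [|p s IH] /=; first exact: compact0.
apply: compactU; first exact: compact_set1.
apply: continuous_compact; last first.
  by apply: compact_setX => //; exact: segment_compact.
apply: continuous_subspaceT => -[t q].
apply: cvgD; first by apply: cvgZr_tmp; exact: cvg_fst.
by apply: cvgZ; [apply: cvgB; [exact: cvg_cst|exact: cvg_fst]|exact: cvg_snd].
Qed.

Lemma convex_hull_seq s : @convex_set R 'rV[R]_n (hull_seq s).
Proof.
apply/convex_setP; elim: s => // p s IH x y l.
have mix l' t q : 0 <= l' <= 1 -> 0 <= t <= 1 -> hull_seq s q ->
    hull_seq (p :: s) (l' *: p + (1 - l') *: (t *: p + (1 - t) *: q)).
  move=> l01 t01 hq; right; exists (l' + (1 - l') * t, q).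
    by split=> //=; rewrite in_itv /=; nra.
  by apply/rowP => i; rewrite !mxE /=; ring.
case=> [/= ->|[[t1 q1] [/= + hq1] <-]].
  case=> [/= ->|[[t2 q2] [/= + hq2] <-]] l01.
    by left; rewrite /= -scalerDl subrKC scale1r.
  by rewrite in_itv /= => t201; exact: mix.
rewrite in_itv /= => t101.
case=> [/= ->|[[t2 q2] [/= + hq2] <-]].
  move=> l01; have mx := mix (1 - l) t1 q1; rewrite subKr in mx.
  by rewrite addrC; apply: mx => //; lra.
rewrite in_itv /= => t201 l01.
(* [a] and [b] are the total weights of [q1] and [q2]; unless both vanish, their normalised
   combination lies in the hull of the tail by induction. *)
pose a := l * (1 - t1); pose b := (1 - l) * (1 - t2).
have a0 : 0 <= a by rewrite mulr_ge0//; lra.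
have b0 : 0 <= b by rewrite mulr_ge0//; lra.
have ab1 : a + b <= 1 by rewrite /a /b; nra.
have [ab0|ab] := eqVneq (a + b) 0.
  have {}a0 : a = 0 by lra. have {}b0 : b = 0 by lra.
  left; apply/rowP => i; rewrite !mxE /=.
  transitivity ((l * t1 + (1 - l) * t2) * p 0 i + a * q1 0 i + b * q2 0 i).
    by rewrite /a /b; ring.
  have -> : l * t1 + (1 - l) * t2 = 1 - a - b by rewrite /a /b; ring.
  by rewrite a0 b0; ring.
have abp : 0 < a + b by rewrite lt_def ab addr_ge0.
right; exists (1 - (a + b), (a / (a + b)) *: q1 + (1 - a / (a + b)) *: q2).
  split; first by rewrite /= in_itv /=; lra.
  apply: IH => //; rewrite divr_ge0 ?ler_pdivrMr//=; lra.
have aE : a / (a + b) * (a + b) = a by rewrite mulfVK.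
apply/rowP => i; rewrite !mxE /=.
transitivity ((1 - a - b) * p 0 i + a / (a + b) * (a + b) * q1 0 i
    + ((a + b) - a / (a + b) * (a + b)) * q2 0 i); first by ring.
by rewrite aE /a /b; ring.
Qed.

Lemma hull_seq_sub s K : @convex_set R 'rV[R]_n K ->
  (forall p, p \in s -> K p) -> hull_seq s `<=` K.
Proof.
move=> /convex_setP cK; elim: s => [_ x []|p s IH hs x /=].
have Kp : K p by apply: hs; rewrite mem_head.
case=> [-> //|[[t q] [/= + hq] <-]]; rewrite in_itv /= => t01.
by apply: cK => //; apply: (IH _ _ hq) => z zs; apply: hs; rewrite inE zs orbT.
Qed.

(** The normal is [x - q] with [q] nearest to [x] in [K]: at a positive product with [z - q], moving
    from [q] towards [z] would approach [x]. *)
Lemma nearest_point_separates K x : compact K -> @convex_set R 'rV[R]_n K ->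
  K !=set0 -> ~ K x -> exists u, forall z, K z -> dot u z < dot u x.
Proof.
move=> cptK cK K0 nKx.
have [|q /set_mem Kq qmin] := EVT_min_rV K0 cptK
    (f := fun z => dot (z - x) (z - x)).
  by apply: continuous_subspaceT => z; exact: continuous_dotB.
exists (x - q) => z Kz.
have xq : 0 < dot (x - q) (x - q).
  by rewrite dot_gt0// subr_eq0; apply: contra_not_neq nKx => ->.
suff : dot (x - q) (z - q) <= 0 by move: xq; rewrite !dotE; lra.
rewrite leNgt; apply/negP => pos.
set u : 'rV[R]_n := x - q in xq pos; set w : 'rV[R]_n := z - q in pos.
have ww := dot_ge0 w.
pose t := dot u w / (1 + dot w w + dot u w).
have d0 : 0 < 1 + dot w w + dot u w by lra.
have t0 : 0 < t by rewrite divr_gt0.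
have tE : t * (1 + dot w w + dot u w) = dot u w by rewrite mulfVK// gt_eqF.
have t1 : t <= 1 by rewrite ler_pdivrMr//; lra.
have Kt : t *: z + (1 - t) *: q \in K.
  by apply/mem_set; move/convex_setP: cK; apply => //; lra.
have := qmin _ Kt.
have -> : t *: z + (1 - t) *: q - x = t *: w - u.
  by apply/rowP => i; rewrite !mxE; ring.
have -> : q - x = - u by rewrite opprB.
clearbody t u w; rewrite !dotE (dotC w u).
have : 0 < t * (t + t * dot u w + dot u w).
  by rewrite mulr_gt0// !addr_gt0// mulr_gt0.
nra.
Qed.

Lemma locally_conical_polytope C : convex_body C ->
  (forall p, C p -> exists2 r, 0 < r & forall x, C x -> `|x - p| < r ->
     exists2 s, 0 < s & C (x + s *: (x - p))) ->
  n_polytope C.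
Proof.
move=> bC hC; split=> //; have [cptC cC _] := bC.
have /choice[r hr] : forall p, exists r, C p -> 0 < r /\ forall x, C x ->
    `|x - p| < r -> exists2 s, 0 < s & C (x + s *: (x - p)).
  move=> p; have [/hC[r r0 h]|nCp] := pselect (C p); last by exists 0 => /nCp.
  by exists r.
have := cptC; rewrite compact_cover => /(_ _ C (fun p => ball p (r p))).
case=> [p _|x Cx|D DC cov]; first exact: ball_open.
  by exists x => //; apply: ballxx; have [] := hr x Cx.
have /finite_seqP[l lD] := finite_fset D; rewrite lD in cov.
have lC p : p \in l -> C p.
  by move=> pl; apply/set_mem/DC; have : [set` l] p by []; rewrite -lD.
exists [set` l]; first exact: finite_seq.
rewrite eqEsubset; split; last by apply: smallest_sub.
move=> x Cx K [cK lK]; apply: (hull_seq_sub cK lK).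
apply: contrapT => nx.
have [p0 p0l _] := cov x Cx.
have [u hu] := nearest_point_separates (@compact_hull_seq _)
  (@convex_hull_seq _) (ex_intro _ p0 (mem_hull_seq p0l)) nx.
(* The maximum at [y] is at least the value at [x], hence above the values at all apexes; a step
   from [y] away from its apex would exceed it. *)
have [|y /set_mem Cy ymax] := EVT_max_rV (ex_intro _ x Cx) cptC (f := dot u).
  by apply: continuous_subspaceT => z; exact: continuous_dot.
have [p pD yp] := cov y Cy.
have [_ hp] := hr p (lC p pD).
have [|s s0 Cs] := hp y Cy.
  by rewrite distrC; move: yp; rewrite -ball_normE.
have := ymax _ (mem_set Cs); have := ymax _ (mem_set Cx).
have := hu p (mem_hull_seq pD).
rewrite !dotDr dotZr dotDr dotNr => h1 h2 h3.
have : 0 < s * (dot u y - dot u p) by rewrite mulr_gt0//; lra.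
lra.
Qed.

End LocallyConical.

(** * Points in general position *)

Section SequentialChoice.

Lemma rev_iota0S k : rev (iota 0 k.+1) = k :: rev (iota 0 k).
Proof. by rewrite -[in LHS]addn1 iotaD rev_cat. Qed.

(** Only histories whose members each satisfy [P] with some history need a next term, so [P] can
    carry the facts that later choices rely on. *)
Lemma history_choice (T : eqType) (P : T -> seq T -> Prop) :
  (forall s, (forall e, e \in s -> exists s', P e s') -> exists e, P e s) ->
  exists g : nat -> T, forall k, P (g k) [seq g i | i <- rev (iota 0 k)].
Proof.
move=> hP; have [e0 _] : exists e, P e [::] by apply: hP.
have /choice[step hstep] : forall s, exists e,
    (forall e, e \in s -> exists s', P e s') -> P e s.
  move=> s.
  have [/hP[e he]|ns] := pselect (forall e, e \in s -> exists s', P e s').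
    by exists e.
  by exists e0.
pose h k := iter k (fun s => step s :: s) [::].
have Ph k : P (step (h k)) (h k).
  apply: (hstep); elim: k => //= k IH e; rewrite inE => /predU1P[->|/IH//].
  by exists (h k); exact: hstep.
exists (step \o h) => k.
suff <- : h k = [seq (step \o h) i | i <- rev (iota 0 k)].
  exact: Ph.
by elim: k => // k IH; rewrite rev_iota0S /= -IH.
Qed.

Lemma uniform_radius (R : realType) (T : eqType) (s : seq T)
    (Q : T -> R -> Prop) :
  (forall e r r', Q e r -> r' <= r -> Q e r') ->
  (forall e, e \in s -> exists2 r, 0 < r & Q e r) ->
  exists2 r, 0 < r & forall e, e \in s -> Q e r.
Proof.
move=> QW; elim: s => [_|e s IH hs]; first by exists 1.
have [|r r0 hr] := IH; first by move=> e' es; apply: hs; rewrite inE es orbT.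
have [r' r'0 hr'] := hs e (mem_head _ _).
exists (Num.min r r'); first by rewrite lt_min r0.
move=> e'; rewrite inE => /predU1P[->|/hr h]; [apply: QW hr' _|apply: QW h _].
  by rewrite ge_min lexx orbT.
by rewrite ge_min lexx.
Qed.

End SequentialChoice.

Section GeneralPosition.
Context {R : realType} {n : nat}.
Implicit Types (u a f : 'rV[R]_n) (e : 'rV[R]_n * 'rV[R]_n).

Definition on_hyperplane f e := dot e.1 f == dot e.1 e.2.

Lemma dot_span (X : seq 'rV[R]_n) u f f' :
  (forall x, x \in X -> dot x f = dot x f') ->
  u \in <<X>>%VS -> dot u f = dot u f'.
Proof.
move=> hX uX; rewrite (@coord_span _ _ _ (in_tuple X) u uX).
have dotS (F : 'I_(size X) -> 'rV[R]_n) g :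
    dot (\sum_i F i) g = \sum_i dot (F i) g.
  rewrite (big_morph (dot^~ g) (id1 := 0) (op1 := +%R))//.
    by move=> x y; rewrite dotDl.
  by rewrite -(scale0r 0) dotZl mul0r.
by rewrite !dotS; apply: eq_bigr => i _; rewrite !dotZl hX ?mem_nth.
Qed.

(* For each choice of the hyperplanes through [f], the value of [dot u f] is
   forced when [u] lies in the span of their normals: only finitely many values
   have to be avoided. *)
Lemma generic_position (s : seq ('rV[R]_n * 'rV[R]_n)) u k : 0 < k ->
  \forall t \near 0^'+, forall f, dot u f = t * k ->
    u \notin <<[seq e.1 | e <- s & on_hyperplane f e]>>%VS.
Proof.
move=> k0.
(* A mask records which hyperplanes contain [f]; there are finitely many, so each may be treated
   separately. *)
have : \forall t \near 0^'+, forall (m : (size s).-tuple bool) f,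
    [seq e <- s | on_hyperplane f e] = mask m s -> dot u f = t * k ->
    u \notin <<[seq e.1 | e <- mask m s]>>%VS.
  apply: filter_forall => m.
  have [[f0 [sf0 uf0]]|nf] := pselect (exists f,
    [seq e <- s | on_hyperplane f e] = mask m s /\
    u \in <<[seq e.1 | e <- mask m s]>>%VS); last first.
    by near=> t => f sf _; apply/negP => uf; apply: nf; exists f.
  have forced f : [seq e <- s | on_hyperplane f e] = mask m s ->
      dot u f = dot u f0.
    move=> sf; apply: dot_span uf0 => _ /mapP[e em ->].
    have : e \in [seq e <- s | on_hyperplane f e] by rewrite sf.
    have : e \in [seq e <- s | on_hyperplane f0 e] by rewrite sf0.
    by rewrite !mem_filter => /andP[/eqP -> _] /andP[/eqP -> _].
  (* The forced value is missed since [t * k] is positive and, for small [t], below any given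
     positive number. *)
  have [b0|b0] := leP (dot u f0) 0.
    near=> t => f /forced ->; have : 0 < t by near: t; exact: nbhs_right_gt.
    move=> t0 e; have : 0 < t * k by rewrite mulr_gt0.
    by rewrite -e ltNge b0.
  near=> t => f /forced ->.
  have : t < dot u f0 / k by near: t; apply: nbhs_right_lt; rewrite divr_gt0.
  by rewrite ltr_pdivlMr// => /[swap] ->; rewrite ltxx.
apply: filterS => t ht f uf.
have sz : size (map (on_hyperplane f) s) == size s by rewrite size_map.
by rewrite filter_mask; apply: (ht (Tuple sz) f); rewrite // filter_mask.
Unshelve. all: by end_near.
Qed.

(** The normals of the hyperplanes through [f] form a free family, each lying outside the span of
    the earlier ones. *)
Lemma count_hyperplanes (g : nat -> 'rV[R]_n * 'rV[R]_n) f N :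
  (forall k, on_hyperplane f (g k) ->
    (g k).1 \notin <<[seq e.1 | e <- [seq g i | i <- rev (iota 0 k)] &
      on_hyperplane f e]>>%VS) ->
  (count (fun k => on_hyperplane f (g k)) (iota 0 N) <= n)%N.
Proof.
move=> hg; pose X k := [seq e.1 | e <- [seq g i | i <- rev (iota 0 k)] &
  on_hyperplane f e].
have XS k : X k.+1 = if on_hyperplane f (g k) then (g k).1 :: X k else X k.
  by rewrite /X rev_iota0S /=; case: ifP.
have freeX k : free (X k).
  elim: k => [|k IH]; first exact: nil_free.
  by rewrite XS; case: ifPn => // fk; rewrite free_cons hg.
have <- : size (X N) = count (fun k => on_hyperplane f (g k)) (iota 0 N).
  by rewrite size_map size_filter count_map count_rev.
have := freeX N; rewrite /free => /eqP <-.
by rewrite (leq_trans (dimvS (subvf _)))// dimvf /dim /= mul1n.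
Qed.

End GeneralPosition.

(** * Finite intersections of translates *)

Section FinitelyGenerated.
Context {R : realType} {n : nat}.
Implicit Types (C A F K : set 'rV[R]_n) (a c f p u v w x y z : 'rV[R]_n).

Lemma translateE C x a : translate x C a <-> C (a - x).
Proof.
split=> [[y Cy <-]|Ca]; first by rewrite addrC addKr.
by exists (a - x) => //; rewrite addrC subrK.
Qed.

(** A translate of [C] contains [A] exactly when it contains the intersection [K] of all such
    translates. Translates of [C] being ball convex, they contain [K] as soon as they contain its
    finite generating set. *)
Lemma finite_translates C :
  (forall K, ball_convex C K -> finitely_generated C K) ->
  forall A, exists s : seq 'rV[R]_n, forall x,
    (forall a, A a -> C (a + x)) <-> (forall f, f \in s -> C (f + x)).
Proof.
move=> hC A.
pose K := \bigcap_(x in [set x | A `<=` translate x C]) translate x C.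
have AK : A `<=` K by move=> a Aa x; apply.
have bK : ball_convex C K.
  apply: Or33; rewrite eqEsubset; split=> [a Ka x|a Ka x Ax]; first exact.
  by apply: Ka => b; apply.
have [F /finite_seqP[s ->] KF] := hC K bK.
exists s => x.
have AC : A `<=` translate (- x) C <-> forall a, A a -> C (a + x).
  split=> [Ax a /Ax/translateE|Ax a Aa]; first by rewrite opprK.
  by apply/translateE; rewrite opprK; exact: Ax.
split=> [/AC Ax f fs|sx].
  suff /translateE : translate (- x) C f by rewrite opprK.
  suff : K f by apply.
  by rewrite KF => L [_]; apply.
apply/AC => a /AK; rewrite KF; apply; split=> [|f fs]; last first.
  by apply/translateE; rewrite opprK; exact: sx.
apply: Or33; rewrite eqEsubset; split=> [b xb y|b]; first exact.
exact.
Qed.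

(* The touching points of the intersection of the [C - a], [a] in [A], are
   touching points of some [C - f]. *)
Lemma touch_transfer C A (s : seq 'rV[R]_n) c y a e :
  @convex_set R 'rV[R]_n C ->
  (forall x,
     (forall a, A a -> C (a + x)) <-> (forall f, f \in s -> C (f + x))) ->
  touch C c y -> A a -> 0 < e ->
  (forall v b, `|v| < e -> A b -> C (y + v) -> C (b + (y - a + v))) ->
  exists2 f, f \in s & dot (y - c) f = dot (y - c) a.
Proof.
move=> cC hs ty Aa e0 hA; have [Cy nCy yc yC] := ty.
have sC v : `|v| < e -> C (y + v) -> forall f, f \in s -> C (f + (y - a + v)).
  by move=> ve Cv; apply/hs => b Ab; exact: hA.
apply: contrapT => nf.
(* Otherwise a small ball tangent at [y], moved by [f - a], touches the boundary at [f + (y - a)];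
   the support inequalities at both points put [f] on the hyperplane of [a]. *)
have sint f : f \in s -> C° (f + (y - a)).
  move=> fs; apply: contrapT => nCf; apply: nf; exists f => //.
  have [r r0 hr] := touch_shrink ty e0.
  set x := f + (y - a) in nCf; set u : 'rV[R]_n := y - c in hr *.
  have u0 : u != 0 by rewrite subr_eq0.
  have tx : touch C (x - r *: u) x.
    split=> //.
    - have := sC 0; rewrite normr0 !addr0; exact.
    - apply/eqP => /(congr1 (fun z => x - z)); rewrite subrr subKr => /esym/eqP.
      by rewrite scaler_eq0 gt_eqF//= (negbTE u0).
    move=> z; rewrite subKr dotZl dotZr mulrA -expr2 => zlt.
    have zE : z = f + (y - a + (z - x)).
      by rewrite addrA subrKC.
    have [|Cz ze] := hr (y + (z - x)).
      move: zlt; congr (_ < _); congr (dot _ _);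
        by apply/rowP => i; rewrite !mxE; ring.
    rewrite zE; apply: sC => //.
    by move: ze; rewrite addrC addKr.
  have := touch_max cC tx Cy; rewrite subKr !dotZl ler_pM2l// => h1.
  have [Cx _ _ _] := tx; have := touch_max cC ty Cx; rewrite -/u => h2.
  by move: h1 h2; rewrite /x !dotDr dotNr; lra.
(* All constraints of [s] are thus slack near [y - a]; by [hs] so is that of [a], which makes [y]
   interior. *)
have [d d0 hd] : exists2 d, 0 < d & forall f, f \in s ->
    forall v, `|v| < d -> C (f + (y - a) + v).
  apply: uniform_radius => [f r r' h r'r v vr'|f /sint/interior_ballP[d d0 hd]].
    by apply: h; exact: lt_le_trans r'r.
  by exists d.
apply/nCy/interior_ballP; exists d => // v vd.
have -> : y + v = a + (y - a + v) by rewrite addrA subrKC.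
by apply: (hs (y - a + v)).2 Aa => f fs; rewrite addrA; exact: hd.
Qed.

Lemma not_flexible C p : convex_body C ->
  (forall K, ball_convex C K -> finitely_generated C K) -> C p ->
  exists2 r, 0 < r & forall c y, touch C c y -> `|y - p| < r ->
    dot (y - c) y <= dot (y - c) p.
Proof.
move=> [_ cC _] hC Cp; apply: contrapT => flex.
have {}flex r : 0 < r -> exists c y, [/\ touch C c y, `|y - p| < r &
    dot (y - c) p < dot (y - c) y].
  move=> r0; apply: contrapT => nf; apply: flex; exists r => // c y ty yr.
  by rewrite leNgt; apply/negP => lt; apply: nf; exists c, y.
(* A stage is a ball centre, a touching point, a shift and a margin, in this order. *)
pose T := ('rV[R]_n * 'rV[R]_n * 'rV[R]_n * R)%type.
pose pt (e : T) := e.1.1.2; pose nrm (e : T) : 'rV[R]_n := pt e - e.1.1.1.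
pose shift (e : T) := e.1.2; pose rad (e : T) := e.2.
pose hyp e := (nrm e, shift e).
(* [rad e] is a margin within which the constraints of all the other stages
   stay inactive around [pt e - shift e]. *)
pose P (e : T) (s : seq T) :=
  [/\ touch C e.1.1.1 (pt e) /\ C° (p + shift e),
      0 < rad e /\ forall v, `|v| < 2 * rad e -> C (pt e - shift e + v),
      forall e', e' \in s -> `|shift e| < rad e',
      forall e', e' \in s -> forall v, `|v| < rad e ->
        C (pt e - shift e + shift e' + v) &
      forall f, on_hyperplane f (hyp e) -> nrm e \notin
        <<[seq h.1 | h <- [seq hyp e' | e' <- s] & on_hyperplane f h]>>%VS].
have [s hs|g Pg] := @history_choice T P.
  (* The factor 2 leaves room for both [(1 - t) *: (y - p)] and a perturbation, each shorter than
     [r]. *)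
  have [r r0 hr] : exists2 r, 0 < r & forall e, e \in s ->
      r <= rad e /\ forall w, `|w| < 2 * r -> C (p + shift e + w).
    apply: uniform_radius =>
      [e r r' [rle rC] r'r|e /hs[s' [[_ Ca] [e0 _] _ _ _]]].
      split; first exact: le_trans rle.
      by move=> w wr'; apply: rC; lra.
    have /interior_ballP[d d0 hd] := Ca.
    exists (Num.min (rad e) (d / 2)); first by rewrite lt_min e0 divr_gt0.
    split=> [|w wlt]; first by rewrite ge_min lexx.
    apply: hd; apply: lt_le_trans wlt _.
    by rewrite mulrC -ler_pdivlMr// ge_min lexx orbT.
  have [c [y [ty yr py]]] := flex r r0.
  have k0 : 0 < dot (y - c) (y - p) by rewrite dotDr dotNr subr_gt0.
  have [t [[t0 t1] tgen]] : exists t, (0 < t /\ t < 1) /\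
      forall f, dot (y - c) f = t * dot (y - c) (y - p) -> y - c \notin
        <<[seq h.1 | h <- [seq hyp e' | e' <- s] & on_hyperplane f h]>>%VS.
    apply: (@filter_ex _ (0 : R)^'+); near=> t; split; first split.
    - by near: t; exact: nbhs_right_gt.
    - by near: t; exact: nbhs_right_lt.
    - by near: t; exact: generic_position.
  pose a := t *: (y - p).
  have Cpa : C° (p + a).
    have -> : p + a = y + (1 - t) *: (p - y).
      by apply/rowP => i; rewrite !mxE; ring.
    by apply: touch_segment ty _ _ _ => //; lra.
  have /interior_ballP[d d0 hd] : C° (y - a).
    have -> : y - a = y + t *: (p - y).
      by apply/rowP => i; rewrite !mxE; ring.
    by apply: touch_segment ty _ _ _ => //; lra.
  (* Half of [d], since the margin must absorb a perturbation and the shift of a later stage. *)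
  pose q := Num.min r (d / 2).
  have q0 : 0 < q by rewrite lt_min r0 divr_gt0.
  have qr : q <= r by rewrite ge_min lexx.
  have qd : 2 * q <= d by rewrite mulrC -ler_pdivlMr// ge_min lexx orbT.
  exists (c, y, a, q); split => //=.
  - by split=> // v vq; apply: hd; exact: lt_le_trans qd.
  - move=> e /hr[re _]; apply: lt_le_trans re; apply: le_lt_trans yr.
    by rewrite /shift /= /a normrZ gtr0_norm// ler_piMl// ltW.
  - move=> e /hr[_ eC] v vq; rewrite /pt /shift /=.
    have -> : y - a + e.1.2 + v = p + shift e + ((1 - t) *: (y - p) + v).
      by apply/rowP => i; rewrite !mxE; ring.
    apply: eC; apply: le_lt_trans (ler_normD _ _) _.
    rewrite normrZ gtr0_norm ?subr_gt0//.
    have := normr_ge0 (y - p); move: vq yr; rewrite /rad /=; nra.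
  - move=> f /eqP; rewrite /hyp /nrm /shift /pt /= /a dotZr; exact: tgen.
have [l hl] := finite_translates hC [set shift (g k) | k in setT].
have hit k : has (fun f => on_hyperplane f (hyp (g k))) l.
  have [[tk _] [r0 kr] _ ks _] := Pg k.
  have [|||f fl fk] := touch_transfer cC hl tk
    (e := rad (g k)) (a := shift (g k)).
  - by exists k.
  - by [].
  - move=> v _ ve [j _ <-] Cv.
    have mem i j' : (i < j')%N -> g i \in [seq g i | i <- rev (iota 0 j')].
      by move=> ij; apply: map_f; rewrite mem_rev mem_iota.
    (* Earlier constraints are slack by the choice of stage [k], later ones because later shifts are
       below its margin; its own is the assumption [Cv]. *)
    have [jk|kj|->] := ltngtP j k.
    + by rewrite addrA [shift _ + _]addrC; apply: ks => //; exact: mem.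
    + have [_ _ js _ _] := Pg j.
      rewrite addrCA; apply: kr; apply: le_lt_trans (ler_normD _ _) _.
      by have := js _ (mem _ _ kj); lra.
    + by rewrite addrA subrKC.
  by apply/hasP; exists f => //; rewrite /on_hyperplane; exact/eqP.
(* Each point of a list serves at most [n] stages, while by [hit] every stage is served by [l]; one
   stage more than [n * size l] is too many. *)
have fewer (s : seq 'rV[R]_n) N : (count (fun k =>
    has (fun f => on_hyperplane f (hyp (g k))) s) (iota 0 N) <= n * size s)%N.
  elim: s => [|f s IH] /=; first by rewrite count_pred0.
  rewrite mulnS; apply: leq_trans (leq_add _ IH); last first.
    apply: (@count_hyperplanes _ _ (hyp \o g) f N) => k fk.
    have [_ _ _ _ /(_ f fk)] := Pg k.
    by rewrite -map_comp.
  by rewrite -count_predUI leq_addr.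
have := fewer l (n * size l).+1.
rewrite (eq_count (a2 := predT)) => [|k]; last by rewrite hit.
by rewrite count_predT size_iota ltnn.
Unshelve. all: by end_near.
Qed.

End FinitelyGenerated.

Theorem lemma6p4 (R : realType) (n : nat) (C : set 'rV[R]_n) :
  convex_body C ->
  (forall K : set 'rV[R]_n, ball_convex C K -> finitely_generated C K) ->
  n_polytope C.
Proof.
move=> bC hC; apply: locally_conical_polytope => // p Cp.
have [r r0 hr] := not_flexible bC hC Cp.
by exists r => // x; exact: locally_conical.
Qed.
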